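(* Let $X$ be a finite nonempty set. The multiset $\binom{X}{1}\cup 3\binom{X}{2}\cup 2\binom{X}{3}$ can be partitioned into parallel classes if and only if either $|X|=1$, or $|X|\equiv 0,2\pmod 3$ and $|X|\neq 3$.
   Context: For a set $X$ and $a\in\mathbb N$, $\binom{X}{a}$ is the collection of all $a$-element subsets of $X$, and $aY$ denotes the multiset consisting of $a$ copies of each element of $Y$; so $\binom{X}{1}\cup 3\binom{X}{2}\cup 2\binom{X}{3}$ is the multiset containing each singleton of $X$ once, each $2$-subset three times and each $3$-subset twice. A parallel class of this multiset is a partition $\mathcal P$ of $X$ with $\mathcal P\subseteq\binom{X}{1}\cup\binom{X}{2}\cup\binom{X}{3}$; partitioning the multiset into parallel classes means writing it as a multiset union of sub-multisets each of which is a parallel class. *)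

(* Defs.v *)
From mathcomp Require Import all_boot finmap multiset.

Set Implicit Arguments.
Unset Strict Implicit.
Unset Printing Implicit Defensive.

Definition subsets_of_size (T : finType) (X : {set T}) (a : nat) : {set {set T}} :=
  [set A in powerset X | #|A| == a].

Definition copies (K : finType) (a : nat) (Y : {set K}) : {mset K}%mset :=
  [fsfun y in [fset y in Y]%fset => a].

(* The union of multisets adds multiplicities; since the three families of
   subsets are pairwise disjoint, taking the maximum would give the same
   multiset here. *)
Definition subsets_multiset (T : finType) (X : {set T}) : {mset {set T}}%mset :=
  (copies 1 (subsets_of_size X 1) `+` copies 3 (subsets_of_size X 2)
     `+` copies 2 (subsets_of_size X 3))%mset.

Definition parallel_class (T : finType) (X : {set T}) (P : {set {set T}}) : bool :=
  partition P X &&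
  (P \subset subsets_of_size X 1 :|: subsets_of_size X 2 :|: subsets_of_size X 3).

(* The parallel classes form a sequence, so the same class may be used several
   times; each class is added as a multiset with multiplicities 0 and 1. *)
Definition partitionable_into_parallel_classes
    (T : finType) (X : {set T}) (M : {mset {set T}}%mset) : Prop :=
  exists2 Ps : seq {set {set T}}, all (parallel_class X) Ps &
    M = \big[@msetD {set T}/mset0]_(P <- Ps) copies 1 P.

(* Main.v *)
Require Import Defs.
From mathcomp Require Import all_boot finmap multiset.
From mathcomp Require Import zify.

Set Implicit Arguments.
Unset Strict Implicit.
Unset Printing Implicit Defensive.

(** Let [n = #|X|]. Double counting shows that there must be [n ^ 2] classes. By
    Baranyai's theorem the multiset can be partitioned into parallel classes as
    soon as one can choose [n ^ 2] triples (number of singletons, pairs and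
    triples in a class), each adding up to [n] points, whose total is
    [(n, 3 'C(n, 2), 2 'C(n, 3))].
    - If [n = 3k] with [k >= 2], use [n] times [(1, 1, k-1)], [k(9k-5)/2] times
      [(0, 3, k-2)] and [k(9k-1)/2] times [(0, 0, k)].
    - If [n = 3k+2] with [k >= 1], use [n] times [(1, 2, k-1)],
      [q = (3k+2)(k-1)/2] times [(0, 4, k-2)] and [n(n-1) - q] times [(0, 1, k)].
    - If [n = 1 mod 3], every class [(a, b, c)] has [2a + b >= 2]; summing gives
      [2n + 3 'C(n, 2) >= 2 n ^ 2], hence [n = 1].
    - If [n = 3], every class has [b <= a], whereas the totals are [9] and [3]. *)

(** * Hall's marriage theorem *)

(* Rado's argument: if [F a] contains [b1 != b2], one of them can be deleted from
   [F a] while preserving Hall's condition; otherwise submodularity of the size of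
   the neighbourhood contradicts the condition. *)
Theorem Hall (A B : finType) (F : A -> {set B}) :
  (forall S : {set A}, #|S| <= #|\bigcup_(a in S) F a|) ->
  exists2 h : A -> B, injective h & forall a, h a \in F a.
Proof.
move: {2}(\sum_a #|F a|).+1 (ltnSn (\sum_a #|F a|)) => m.
elim: m F => // m IHm F; rewrite ltnS => leFm hallF.
have [/existsP[a gt1]|] := boolP [exists a, 1 < #|F a|]; last first.
  rewrite negb_exists => /forallP le1.
  have card1 a : #|F a| == 1.
    by rewrite eqn_leq leqNgt le1 /=; have := hallF [set a]; rewrite big_set1 cards1.
  have Fh a : exists b, F a == [set b] by have /cards1P[b ->] := card1 a; exists b.
  have [h {}Fh] := fin_all_exists Fh; exists h => [a a' eqh|a]; last first.
    by rewrite (eqP (Fh a)) set11.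
  apply/eqP/contraT => neq; have := hallF [set a; a'].
  by rewrite bigcup_setU !big_set1 (eqP (Fh a)) (eqP (Fh a')) eqh setUid cards1 cards2 neq.
have [b1 [b2 [Fb1 Fb2 neqb]]] := card_gt1P gt1.
pose del b a' := if a' == a then F a :\ b else F a'.
have del_small b : b \in F a -> \sum_a' #|del b a'| < m.
  move=> Fb; apply: leq_trans leFm; rewrite (bigD1 a) //= [X in _ < X](bigD1 a) //=.
  rewrite /del eqxx (cardsD1 b (F a)) Fb add1n ltnS leq_add2l.
  by apply: leq_sum => i /negPf->.
(* If deleting [b] breaks Hall's condition, a violating set must contain [a], as the other sets are
   unchanged; [R] is the rest of it. *)
have delP b : b \in F a ->
    (exists2 h : A -> B, injective h & forall a, h a \in F a) \/
    exists2 R : {set A}, a \notin R &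
      #|F a :\ b :|: \bigcup_(a' in R) F a'| <= #|R|.
  move=> Fb.
  have [/forallP hall_del|] :=
    boolP [forall S : {set A}, #|S| <= #|\bigcup_(a' in S) del b a'|].
    have [h hI hF] := IHm _ (del_small b Fb) hall_del; left; exists h => // a'.
    by have := hF a'; rewrite /del; case: eqP => [->|//] /setD1P[].
  rewrite negb_forall => /existsP[S]; rewrite -ltnNge => ltS; right.
  have Sa : a \in S.
    apply/contraT => aNS; have := hallF S; rewrite leqNgt => /negP[].
    apply: leq_trans ltS; rewrite ltnS; apply/subset_leq_card/subsetP => y.
    move=> /bigcupP[a' Sa' Fy]; apply/bigcupP; exists a' => //.
    by rewrite /del; case: eqP => // eqa; rewrite -eqa Sa' in aNS.
  exists (S :\ a); first by rewrite setD11.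
    rewrite (cardsD1 a S) Sa add1n ltnS in ltS.
  apply: leq_trans ltS; rewrite [in leqRHS](big_setD1 a) //= {1}/del eqxx.
  apply: eq_leq; congr #|pred_of_set (_ :|: _)|; apply: eq_bigr => a'.
  by rewrite in_setD1 /del => /andP[/negPf->].
have [//|[R1 aR1 le1]] := delP b1 Fb1; have [//|[R2 aR2 le2]] := delP b2 Fb2.
have := hallF (a |: (R1 :|: R2)); have := hallF (R1 :&: R2).
set P1 := (X in #|pred_of_set X| <= #|R1|) in le1.
set P2 := (X in #|pred_of_set X| <= #|R2|) in le2.
have subI : \bigcup_(i in R1 :&: R2) F i \subset P1 :&: P2.
  apply/bigcupsP => i /setIP[iR1 iR2]; rewrite subsetI /P1 /P2.
  by rewrite !(subset_trans (bigcup_sup i _) (subsetUr _ _)).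
(* Since [b1 != b2], every element of [F a] survives one of the two deletions. This yields the extra
   1 in the contradiction [#|P1| + #|P2| > #|R1| + #|R2|]. *)
have subU : \bigcup_(i in a |: (R1 :|: R2)) F i \subset P1 :|: P2.
  rewrite !bigcup_setU big_set1 /P1 /P2; apply/subsetP => y; rewrite !inE.
  case/or3P=> ->; rewrite ?orbT // !andbT.
  by case: (eqVneq y b1) => [->|//]; rewrite neqb !orbT.
have := subset_leq_card subI; have := subset_leq_card subU.
have := cardsUI P1 P2; have := cardsUI R1 R2.
rewrite cardsU1 !inE (negPf aR1) (negPf aR2) /=; lia.
Qed.

(** * Baranyai's theorem *)

(* Hall's condition for the graph joining [i] to [r u] copies of each vertex [u]:
   give the edge from [i] to [v i j] weight [w (v i j)], so that the degree of
   [i] is [d] and that of [u] is [d * r u]. *)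
Lemma regular_selection (I J V : finType) (v : I -> J -> V) (w r : V -> nat) d :
  0 < d -> (forall i, \sum_j w (v i j) = d) ->
  (forall u, w u * \sum_i \sum_j (v i j == u) = d * r u) ->
  exists2 c : I -> J, forall i, 0 < w (v i (c i)) &
    forall u, \sum_i (v i (c i) == u) = r u.
Proof.
move=> d_gt0 degI degV.
pose W := {u : V & 'I_(r u)}.
pose N i := [set t : W | [exists j, (0 < w (v i j)) && (v i j == tag t)]].
have cardW (P : pred V) : #|[set t : W | P (tag t)]| = \sum_(u | P u) r u.
  rewrite -sum1dep_card -(eq_bigl _ _ (fun t => andbT (P (tag t)))).
  rewrite -(sig_big_dep P (fun _ _ => true) (fun _ _ => 1)) /=.
  by apply: eq_bigr => u _; rewrite sum1_card card_ord.
have degD (D : {set I}) :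
    d * #|D| = \sum_u \sum_(i in D) \sum_j (v i j == u) * w u.
  rewrite exchange_big /= -sum1_card big_distrr /=; apply: eq_bigr => i _.
  rewrite exchange_big /= muln1 -(degI i); apply: eq_bigr => j _.
  rewrite (bigD1 (v i j)) //= eqxx mul1n big1 ?addn0 // => u.
  by rewrite eq_sym => /negPf->.
(* The weight [d * #|D|] leaving [D] ends in neighbours of [D], each of which absorbs at most
   [d * r u]; edges of weight 0 carry nothing. *)
have hall (D : {set I}) : #|D| <= #|\bigcup_(i in D) N i|.
  pose P u := [exists i in D, exists j, (0 < w (v i j)) && (v i j == u)].
  have -> : \bigcup_(i in D) N i = [set t : W | P (tag t)].
    apply/setP => t; rewrite inE; apply/bigcupP/exists_inP => -[i Di];
      by rewrite ?inE; exists i; rewrite ?inE.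
  rewrite cardW -(leq_pmul2l d_gt0) big_distrr /= degD [leqRHS]big_mkcond /=.
  apply: leq_sum => u _; case: ifPn => [_|nPu].
    rewrite -degV big_distrr /= [leqRHS](bigID [in D]) /=.
    apply: leq_trans (leq_addr _ _); apply: leq_sum => i _.
    by rewrite big_distrr /=; apply: leq_sum => j _; rewrite mulnC.
  rewrite big1 // => i Di; rewrite big1 // => j _; apply/eqP; rewrite -leqn0 leqNgt.
  apply: contra nPu; rewrite muln_gt0 lt0b => /andP[/eqP <- w_gt0].
  by apply/exists_inP; exists i => //; apply/existsP; exists j; rewrite w_gt0 /=.
have [h hI hN] := Hall hall.
have hc i : exists j, (0 < w (v i j)) && (v i j == tag (h i)).
  by have := hN i; rewrite inE => /existsP.
have [c {}hc] := fin_all_exists hc.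
exists c => [i|u]; first by have /andP[] := hc i.
have le_r u' : \sum_i (v i (c i) == u') <= r u'.
  have := cardW (pred1 u'); rewrite big_pred1_eq => <-.
  rewrite -big_mkcond /= sum1dep_card -(card_imset _ hI).
  apply/subset_leq_card/subsetP => t /imsetP[i]; rewrite !inE => /eqP <- ->.
  by have /andP[_ /eqP->] := hc i.
(* Injectivity of [h] gives only [le_r]; as both sides have total [#|I|], equality holds at every
   vertex. *)
have sum_r : \sum_u r u = #|I|.
  apply/eqP; rewrite -(eqn_pmul2l d_gt0) -cardsT degD big_distrr /=; apply/eqP.
  apply: eq_bigr => u' _; rewrite -degV big_distrr /=; apply: eq_big => [i|i _].
    by rewrite inE.
  by rewrite big_distrr /=; apply: eq_bigr => j _; rewrite mulnC.
have sum_c : \sum_u \sum_i (v i (c i) == u) = #|I|.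
  rewrite exchange_big /= -sum1_card; apply: eq_bigr => i _.
  by rewrite (bigD1 (v i (c i))) //= eqxx big1 // => u'; rewrite eq_sym => /negPf->.
apply/eqP; rewrite eqn_leq le_r leqNgt; apply/negP => lt_r.
suff : \sum_u \sum_i (v i (c i) == u) < \sum_u r u by rewrite sum_r sum_c ltnn.
rewrite (bigD1 u) //= [ltnRHS](bigD1 u) //= -addSn leq_add //.
by apply: leq_sum => u' _.
Qed.

Lemma sum_mem_card (T : finType) (A : {set T}) : \sum_x (x \in A) = #|A|.
Proof. by rewrite -big_mkcond sum1_card. Qed.

(* The points are inserted one by one. When [Y] has been distributed, the block
   [f i j] still misses [sz (tau i j) - #|f i j|] points; these numbers are the
   weights that let [regular_selection] choose, in every class [i], the block
   receiving the next point. *)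
Lemma baranyai_partial (T I J L : finType) (X : {set T}) (sz lam : L -> nat)
    (tau : I -> J -> L) :
  (forall i, \sum_j sz (tau i j) = #|X|) ->
  (forall t, \sum_i \sum_j (tau i j == t) = lam t * 'C(#|X|, sz t)) ->
  forall Y : {set T}, Y \subset X -> exists f : I -> J -> {set T},
    [/\ forall i x, \sum_j (x \in f i j) = (x \in Y),
        forall i j, #|f i j| <= sz (tau i j) &
        forall t (S : {set T}), S \subset Y -> #|S| <= sz t ->
          \sum_i \sum_j ((tau i j == t) && (f i j == S)) =
            lam t * 'C(#|X| - #|Y|, sz t - #|S|)].
Proof.
move=> sumX lamX Y; move: {2}#|Y| (erefl #|Y|) => m.
elim: m Y => [|m IHm] Y cardY YX.
  rewrite (cards0_eq cardY); exists (fun _ _ => set0); split=> [i x|i j|t S].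
  - by rewrite big1 ?inE // => j _; rewrite inE.
  - by rewrite cards0.
  - rewrite subset0 => /eqP-> _; rewrite cards0 !subn0 -lamX.
    by apply: eq_bigr => i _; apply: eq_bigr => j _; rewrite eqxx andbT.
have [x Yx] : exists x, x \in Y by apply/card_gt0P; rewrite cardY.
have cardYx : #|Y :\ x| = m by move: cardY; rewrite (cardsD1 x) Yx => -[].
have YxX : Y :\ x \subset X by apply: subset_trans YX; apply: subD1set.
have [f [fY f_sz f_lam]] := IHm _ cardYx YxX.
have ltmX : m < #|X| by rewrite -cardY subset_leq_card.
have fsub i j : f i j \subset Y :\ x.
  apply/subsetP => y fy; have := fY i y.
  by rewrite (bigD1 j) //= fy; case: (y \in _).
have xNf i j : x \notin f i j by apply: contra (subsetP (fsub i j) x) _; rewrite setD11.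
have sum_card i : \sum_j #|f i j| = m.
  rewrite -cardYx -sum_mem_card -(eq_bigr _ (fun y _ => fY i y)) exchange_big.
  by apply: eq_bigr => j _; rewrite sum_mem_card.
pose d := #|X| - m.
(* The number of blocks with label and content [u] that must receive [x]; the degree condition is
   [k 'C(d, k) = d 'C(d-1, k-1)]. The guard excludes full blocks, for which the truncated
   predecessor would give ['C(d-1, 0) = 1] instead of 0. *)
pose r (u : L * {set T}) := if (u.2 \subset Y :\ x) && (#|u.2| < sz u.1)
  then lam u.1 * 'C(d.-1, (sz u.1 - #|u.2|).-1) else 0.
have [|i|[t S]|c c_gt0 c_r] := @regular_selection I J (L * {set T})%type
    (fun i j => (tau i j, f i j)) (fun u => sz u.1 - #|u.2|) r d.
- by rewrite subn_gt0.
- by rewrite /= sumnB // sumX sum_card.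
- rewrite /r /=; under eq_bigr do under eq_bigr do rewrite xpair_eqE.
  have [SY|SNY] := boolP (S \subset _); last first.
    rewrite big1 ?muln0 // => i _; rewrite big1 // => j _.
    by case: eqP => //= _; case: eqP => // eqS; rewrite -eqS fsub in SNY.
  have [lt_sz|le_sz] := ltnP #|S| (sz t); last by rewrite (eqP le_sz) mul0n muln0.
  rewrite f_lam ?(ltnW lt_sz) // cardYx -/d /= mulnCA [RHS]mulnCA; congr (_ * _).
  by move: lt_sz; rewrite -subn_gt0; case: (sz t - #|S|) => // k _; rewrite mul_bin_diag.
exists (fun i j => if j == c i then x |: f i j else f i j); split=> [i y|i j|t S SY le_sz].
- have := fY i y; rewrite (bigD1 (c i)) //= [in X in _ -> X](bigD1 (c i)) //= eqxx.
  under [in X in _ -> X]eq_bigr => j /negPf-> do [].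
  rewrite !inE; case: eqP => [->|//]; rewrite (negPf (xNf _ _)) Yx /= => ?; lia.
- case: eqP => [->|//]; rewrite cardsU1 xNf add1n.
  by have := c_gt0 i; rewrite subn_gt0.
have -> : #|X| - #|Y| = d.-1 by rewrite cardY /d subnS.
have cU S' : \sum_i ((tau i (c i) == t) && (f i (c i) == S')) = r (t, S').
  by rewrite -c_r; apply: eq_bigr => i _; rewrite xpair_eqE.
rewrite /r /= in cU.
(* Blocks equal to a set [S] containing [x] arise from the chosen copies of [S :\ x]. If [x] is not
   in [S], the unchosen copies of [S] remain, and Pascal's rule counts them. *)
have [Sx|xNS] := boolP (x \in S).
  have SYx : S :\ x \subset Y :\ x by rewrite setSD.
  have cardS : #|S| = #|S :\ x|.+1 by rewrite (cardsD1 x) Sx.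
  have := cU (S :\ x); rewrite SYx -cardS le_sz -subnS -cardS /= => <-.
  apply: eq_bigr => i _; rewrite (bigD1 (c i)) //= eqxx big1 ?addn0 => [|j /negPf->].
    congr (nat_of_bool (_ && _)); apply/eqP/eqP => [<-|->]; last by rewrite setD1K.
    by rewrite setU1K.
  suff /negPf-> : f i j != S by rewrite andbF.
  by apply: contraNneq (xNf i j) => ->.
have SYx : S \subset Y :\ x by rewrite subsetD1 SY.
have := f_lam t S SYx le_sz; rewrite cardYx -/d => f_S.
have split_S : \sum_i \sum_j ((tau i j == t) && (f i j == S)) =
   \sum_i \sum_j ((tau i j == t) && ((if j == c i then x |: f i j else f i j) == S))
   + \sum_i ((tau i (c i) == t) && (f i (c i) == S)).
  rewrite -big_split; apply: eq_bigr => i _; rewrite (bigD1 (c i)) //=.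
  rewrite [in RHS](bigD1 (c i)) //= eqxx [x |: _ == _](_ : _ = false); last first.
    by apply/eqP => eqS; rewrite -eqS setU11 in xNS.
  rewrite andbF add0n addnC; congr (_ + _).
  by apply: eq_bigr => j /negPf->.
have := cU S; rewrite SYx /= => cS; rewrite f_S cS in split_S.
have d_gt0 : 0 < d by rewrite subn_gt0.
apply/eqP; rewrite -(eqn_add2r (if #|S| < sz t
  then lam t * 'C(d.-1, (sz t - #|S|).-1) else 0)) -split_S; apply/eqP.
case: ltnP => [lt_sz|ge_sz].
  rewrite -mulnDr; congr (_ * _); move: lt_sz; rewrite -subn_gt0.
  by case: (sz t - #|S|) => // k _; case: (d) d_gt0 => // e _; rewrite binS.
by rewrite (eqP ge_sz) !bin0 addn0.
Qed.

(** At [Y = X] the binomial coefficients become ['C(0, 0) = 1], and all blocks are full because the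
    prescribed sizes in each class sum to [#|X|]. *)
Theorem baranyai (T I J L : finType) (X : {set T}) (sz lam : L -> nat)
    (tau : I -> J -> L) :
  (forall i, \sum_j sz (tau i j) = #|X|) ->
  (forall t, \sum_i \sum_j (tau i j == t) = lam t * 'C(#|X|, sz t)) ->
  exists f : I -> J -> {set T},
    [/\ forall i x, \sum_j (x \in f i j) = (x \in X),
        forall i j, #|f i j| = sz (tau i j) &
        forall t (S : {set T}), S \subset X -> #|S| = sz t ->
          \sum_i \sum_j ((tau i j == t) && (f i j == S)) = lam t].
Proof.
move=> sumX lamX; have [f [fX f_sz f_lam]] := baranyai_partial sumX lamX (subxx X).
exists f; split=> // [i j|t S SX cardS]; last first.
  by rewrite f_lam ?cardS // !subnn bin0 muln1.
have sum_card : \sum_j' (sz (tau i j') - #|f i j'|) = 0.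
  rewrite sumnB // sumX -sum_mem_card -(eq_bigr _ (fun y _ => fX i y)) exchange_big.
  by apply/eqP; rewrite subn_eq0; apply: leq_sum => j' _; rewrite sum_mem_card.
apply/eqP; rewrite eqn_leq f_sz -subn_eq0 /=.
by move/eqP: sum_card; rewrite sum_nat_eq0 => /forallP/(_ j).
Qed.

Lemma sum_nth_ord (g : nat -> nat) (s : seq nat) m : g 0 = 0 -> size s <= m ->
  \sum_(j < m) g (nth 0 s j) = \sum_(x <- s) g x.
Proof.
move=> g0; elim: s m => [|x s IHs] [|m] // le_sm.
- by rewrite big_ord0 big_nil.
- by rewrite big_nil big1 // => j _; rewrite nth_nil.
- by rewrite big_ord_recl big_cons /= IHs.
Qed.

Lemma leq_nth_sumn (s : seq nat) j : nth 0 s j <= sumn s.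
Proof.
elim: s j => [|x s IHs] [|j] //=; first exact: leq_addr.
exact: leq_trans (IHs j) (leq_addl _ _).
Qed.

(** Each list in [ss] prescribes the block sizes of one class. The sizes themselves serve as labels
    in [baranyai], and dropping empty blocks turns every row into a partition. *)
Corollary baranyai_types (T : finType) (X : {set T}) (ss : seq (seq nat))
    (lam : nat -> nat) :
  all (fun s => sumn s == #|X|) ss ->
  (forall t, 0 < t <= #|X| -> count_mem t (flatten ss) = lam t * 'C(#|X|, t)) ->
  exists2 Ps : seq {set {set T}}, all (fun P => partition P X) Ps &
    forall A : {set T}, A \subset X -> A != set0 ->
      \sum_(P <- Ps) (A \in P) = lam #|A|.
Proof.
move=> /allP sum_ss count_ss.
pose I := 'I_(size ss); pose M := \max_(s <- ss) size s.
pose row (i : I) := nth [::] ss i.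
pose tau (i : I) (j : 'I_M) : 'I_#|X|.+1 := inord (nth 0 (row i) j).
(* Rows are padded with zeros to a common length; [lam' ord0] counts this padding. *)
pose lam' (t : 'I_#|X|.+1) := if t == ord0 then \sum_i \sum_j (tau i j == t) else lam t.
have row_ss i : row i \in ss by rewrite mem_nth.
have size_row i : size (row i) <= M by rewrite /M (big_rem _ (row_ss i)) leq_maxl.
have val_tau i j : tau i j = nth 0 (row i) j :> nat.
  by rewrite inordK // ltnS -(eqP (sum_ss _ (row_ss i))) leq_nth_sumn.
have sum_tau i : \sum_j tau i j = #|X|.
  transitivity (sumn (row i)); last by apply/eqP/sum_ss.
  rewrite sumnE -(sum_nth_ord (g := id) _ (size_row i)) //.
  by apply: eq_bigr => j _; rewrite val_tau.
have count_tau t : \sum_i \sum_j (tau i j == t) = lam' t * 'C(#|X|, t).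
  rewrite /lam'; case: eqP => [->|/eqP t_neq0]; first by rewrite bin0 muln1.
  have t_gt0 : 0 < t by rewrite lt0n.
  rewrite -count_ss; last by rewrite t_gt0 -ltnS ltn_ord.
  rewrite count_flatten sumnE big_map (big_nth [::]) big_mkord.
  apply: eq_bigr => i _; rewrite -sum1_count [RHS]big_mkcond /=.
  rewrite -(sum_nth_ord (g := fun x => if x == t then 1 else 0) _ (size_row i)).
    by apply: eq_bigr => j _; rewrite -val_tau val_eqE; case: eqP.
  by rewrite eq_sym (gtn_eqF t_gt0).
have [f [fX f_sz f_lam]] := baranyai sum_tau count_tau.
have f_inj i j j' x : x \in f i j -> x \in f i j' -> j' = j.
  move=> fj fj'; apply/eqP/contraT => neq; have := fX i x.
  by rewrite (bigD1 j) // (bigD1 j') //= fj fj'; case: (x \in X).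
have f_ex i x : x \in X -> exists j, x \in f i j.
  move=> Xx; apply/existsP/contraT; rewrite negb_exists => /forallP nf.
  by have := fX i x; rewrite Xx big1 // => j _; rewrite (negPf (nf j)).
have f_sub i j : f i j \subset X.
  by apply/subsetP => x fx; have := fX i x; rewrite (bigD1 j) //= fx; case: (x \in X).
pose P i := [set A : {set T} | (A != set0) && [exists j, f i j == A]].
have memP i A : A != set0 -> (A \in P i) = \sum_j (f i j == A) :> nat.
  move=> A0; rewrite inE A0 /=; case: existsP => [[j /eqP fj]|nf].
    rewrite (bigD1 j) //= fj eqxx big1 // => j' neq; case: eqP => // fj'.
    have [x Ax] := set0Pn _ A0.
    by rewrite (@f_inj i j j' x) ?fj ?fj' ?eqxx in neq.
  by rewrite big1 // => j _; case: eqP => // fj; case: nf; exists j; apply/eqP.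
exists [seq P i | i <- enum I] => [|A AX A0].
  apply/allP => _ /mapP[i _ ->]; apply/and3P; split; last by rewrite inE eqxx.
    apply/eqP/setP => x; apply/bigcupP/idP => [[A]|/(f_ex i)[j fx]].
      by rewrite inE => /andP[_ /existsP[j /eqP<-]]; apply: (subsetP (f_sub i j)).
    exists (f i j) => //; rewrite inE; apply/andP; split; first by apply/set0Pn; exists x.
    by apply/existsP; exists j.
  apply/trivIsetP => A A'; rewrite !inE => /andP[_ /existsP[j /eqP<-]].
  move=> /andP[_ /existsP[j' /eqP<-]] neq; apply/pred0P => x /=; apply/negP.
  by case/andP => fx /(f_inj _ _ _ _ fx) eqj; rewrite eqj eqxx in neq.
have leA : #|A| < #|X|.+1 by rewrite ltnS subset_leq_card.
have := f_lam (Ordinal leA) A AX erefl; rewrite /lam' -val_eqE /= cards_eq0 (negPf A0) => <-.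
rewrite big_map big_enum /=; apply: eq_bigr => i _; rewrite memP //.
apply: eq_bigr => j _; case: (eqVneq (f i j) A) => [fA|]; last by rewrite andbF.
by rewrite -val_eqE /= -f_sz fA eqxx.
Qed.

(** * Multiplicities and block counts of parallel classes *)

Definition multiplicity (a : nat) : nat :=
  match a with 1 => 1 | 2 => 3 | 3 => 2 | _ => 0 end.

Lemma copiesE (K : finType) a (Y : {set K}) y : copies a Y y = a * (y \in Y).
Proof. by rewrite fsfunE !inE; case: (y \in Y); rewrite ?muln1 ?muln0. Qed.

Lemma subsets_multisetE (T : finType) (X A : {set T}) :
  subsets_multiset X A = if A \subset X then multiplicity #|A| else 0.
Proof.
rewrite /subsets_multiset !msetE2 !copiesE !inE.
by case: (A \subset X) => //=; case: #|A| => [|[|[|[|m]]]].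
Qed.

Lemma parallel_classE (T : finType) (X : {set T}) (P : {set {set T}}) :
  parallel_class X P = partition P X && [forall A in P, #|A| <= 3].
Proof.
rewrite /parallel_class; case: (boolP (partition P X)) => //= partP.
have sub3 A : A \in P ->
    (A \in subsets_of_size X 1 :|: subsets_of_size X 2 :|: subsets_of_size X 3)
    = (#|A| <= 3).
  move=> PA; rewrite !inE (partitionS partP PA) /=.
  have : 0 < #|A| by rewrite card_gt0 (partition_neq0 partP PA).
  by case: #|A| => [|[|[|[|m]]]].
by apply/subsetP/forall_inP => h A PA; have := h A PA; rewrite sub3.
Qed.

(** Multisets are compared pointwise; a set not contained in [X] has multiplicity 0 on both sides,
    as blocks of a partition lie in [X]. *)
Lemma partitionableP (T : finType) (X : {set T}) :
  partitionable_into_parallel_classes X (subsets_multiset X) <->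
  exists2 Ps : seq {set {set T}}, all (parallel_class X) Ps &
    forall A : {set T}, A \subset X -> \sum_(P <- Ps) (A \in P) = multiplicity #|A|.
Proof.
have bigE (Ps : seq {set {set T}}) (A : {set T}) :
    (\big[@msetD {set T}/mset0]_(P <- Ps) copies 1 P)%mset A = \sum_(P <- Ps) (A \in P).
  elim: Ps => [|P Ps IHPs]; first by rewrite !big_nil mset0E.
  by rewrite !big_cons msetE2 copiesE mul1n IHPs.
split=> -[Ps parPs eqPs]; exists Ps => //.
  by move=> A AX; rewrite -bigE -eqPs subsets_multisetE AX.
apply/msetP => A; rewrite bigE subsets_multisetE; case: ifP => [/eqPs //|AX].
rewrite big1_seq // => P /= /(allP parPs); rewrite parallel_classE => /andP[partP _].
by apply/eqP; rewrite eqb0; apply: contraFN AX; apply: partitionS.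
Qed.

Definition block_count (T : finType) (a : nat) (P : {set {set T}}) : nat :=
  \sum_(A in P) (#|A| == a).

Lemma parallel_class_card (T : finType) (X : {set T}) (P : {set {set T}}) :
  parallel_class X P ->
  block_count 1 P + 2 * block_count 2 P + 3 * block_count 3 P = #|X|.
Proof.
rewrite parallel_classE => /andP[partP /forall_inP le3].
rewrite (card_partition partP) !big_distrr -!big_split /=; apply: eq_bigr => A PA.
have := le3 A PA; have : 0 < #|A| by rewrite card_gt0 (partition_neq0 partP PA).
by case: #|A| => [|[|[|[|m]]]].
Qed.

(** Double counting of the pairs of a class and an [a]-subset belonging to it. *)
Lemma sum_block_count (T : finType) (X : {set T}) (Ps : seq {set {set T}}) a :
  all (parallel_class X) Ps ->
  (forall A : {set T}, A \subset X -> \sum_(P <- Ps) (A \in P) = multiplicity #|A|) ->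
  \sum_(P <- Ps) block_count a P = multiplicity a * 'C(#|X|, a).
Proof.
move=> parPs sumPs; rewrite -cards_draws -sum1dep_card big_distrr /=.
transitivity (\sum_(P <- Ps) \sum_(A : {set T} | (A \subset X) && (#|A| == a)) (A \in P)).
  apply: eq_big_seq => P /(allP parPs); rewrite parallel_classE => /andP[partP _].
  rewrite /block_count big_mkcond [RHS]big_mkcond; apply: eq_bigr => A _ /=.
  have [PA|] := boolP (A \in P); last by case: ifP.
  by rewrite (partitionS partP PA); case: (_ == _).
rewrite exchange_big; apply: eq_bigr => A /andP[AX /eqP cardA].
by rewrite sumPs // cardA muln1.
Qed.

(** * Sufficiency: block sizes with the right totals *)

Lemma bin2_mul n : 'C(n, 2) * 2 = n * n.-1.
Proof. by rewrite -[2 in LHS]/(2`!) bin_ffact ffactnS ffactn1. Qed.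

Lemma bin3_mul n : 'C(n, 3) * 6 = n * n.-1 * n.-2.
Proof. by rewrite -[6]/(3`!) bin_ffact !ffactnS ffactn0 muln1 mulnA. Qed.

(** No block has more than three elements, because [multiplicity] vanishes there. *)
Lemma partitionable_of_types (T : finType) (X : {set T}) (ss : seq (seq nat)) :
  X != set0 -> all (fun s => sumn s == #|X|) ss ->
  (forall t, 0 < t -> count_mem t (flatten ss) = multiplicity t * 'C(#|X|, t)) ->
  partitionable_into_parallel_classes X (subsets_multiset X).
Proof.
move=> X0 sum_ss count_ss; apply/partitionableP.
have [t /andP[t_gt0 _]|Ps /allP partPs sumPs] := baranyai_types (lam := multiplicity) sum_ss.
  exact: count_ss.
have sumPs' (A : {set T}) : A \subset X -> \sum_(P <- Ps) (A \in P) = multiplicity #|A|.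
  have [->|A0] := eqVneq A set0; last by move/sumPs->.
  rewrite cards0 big1_seq // => P /= /partPs partP.
  by rewrite (partition0 partP).
exists Ps => //; apply/allP => P PPs; rewrite parallel_classE partPs //=.
apply/forall_inP => A PA; rewrite leqNgt; apply/negP => gt3.
have := sumPs' A (partitionS (partPs P PPs) PA).
rewrite (big_rem P) //= PA; by case: #|A| gt3 => [|[|[|[|m]]]].
Qed.

Definition classes_of_type (m a b c : nat) : seq (seq nat) :=
  nseq m (nseq a 1 ++ nseq b 2 ++ nseq c 3).

Lemma all_classes_of_type n m a b c :
  m = 0 \/ a + 2 * b + 3 * c = n ->
  all (fun s => sumn s == n) (classes_of_type m a b c).
Proof.
by rewrite all_nseq !sumn_cat !sumn_nseq mul1n addnA => -[->|->]; rewrite ?eqxx ?orbT.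
Qed.

Lemma count_classes_of_type t m a b c :
  count_mem t (flatten (classes_of_type m a b c)) =
    m * ((1 == t) * a + (2 == t) * b + (3 == t) * c).
Proof.
by rewrite count_flatten map_nseq sumn_nseq !count_cat !count_nseq mulnC addnA.
Qed.

Lemma partitionable_of_3_types (T : finType) (X : {set T})
    (n := #|X|) m1 a1 b1 c1 m2 a2 b2 c2 m3 a3 b3 c3 :
  X != set0 ->
  m1 = 0 \/ a1 + 2 * b1 + 3 * c1 = n ->
  m2 = 0 \/ a2 + 2 * b2 + 3 * c2 = n ->
  m3 = 0 \/ a3 + 2 * b3 + 3 * c3 = n ->
  m1 * a1 + m2 * a2 + m3 * a3 = n ->
  m1 * b1 + m2 * b2 + m3 * b3 = 3 * 'C(n, 2) ->
  m1 + m2 + m3 = n ^ 2 ->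
  partitionable_into_parallel_classes X (subsets_multiset X).
Proof.
move=> X0 e1 e2 e3 suma sumb sumc; have n_gt0 : 0 < n by rewrite card_gt0.
apply: (partitionable_of_types (ss := classes_of_type m1 a1 b1 c1 ++
   classes_of_type m2 a2 b2 c2 ++ classes_of_type m3 a3 b3 c3)) => //.
  by rewrite !all_cat !all_classes_of_type.
have sumC : m1 * c1 + m2 * c2 + m3 * c3 = 2 * 'C(n, 3).
  have := bin2_mul n; have := bin3_mul n.
  have e1' : m1 * a1 + 2 * (m1 * b1) + 3 * (m1 * c1) = m1 * n by case: e1 => [->|<-]; lia.
  have e2' : m2 * a2 + 2 * (m2 * b2) + 3 * (m2 * c2) = m2 * n by case: e2 => [->|<-]; lia.
  have e3' : m3 * a3 + 2 * (m3 * b3) + 3 * (m3 * c3) = m3 * n by case: e3 => [->|<-]; lia.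
  have eN : m1 * n + m2 * n + m3 * n = n ^ 2 * n by rewrite -sumc; lia.
  clear e1 e2 e3 sumc.
  case: (n) n_gt0 suma sumb e1' e2' e3' eN => // -[|k] _ /=; nia.
move=> t t_gt0; rewrite !flatten_cat !count_cat !count_classes_of_type.
by case: t t_gt0 => [|[|[|[|t]]]] //= _; rewrite -/n ?bin1; lia.
Qed.

Lemma partitionable_mod3_0 (T : finType) (X : {set T}) :
  X != set0 -> #|X| = 0 %[mod 3] -> #|X| <> 3 ->
  partitionable_into_parallel_classes X (subsets_multiset X).
Proof.
move=> X0 mod3 neq3; pose k := #|X| %/ 3.
have cardX : #|X| = 3 * k by rewrite /k; lia.
have k_gt1 : 1 < k by move: X0; rewrite -card_gt0; lia.
(* One of the two factors is even, so the halving is exact. *)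
have p2 : (k * (9 * k - 1))./2 * 2 = k * (9 * k - 1).
  by rewrite muln2 even_halfK // oddM oddB ?oddM //=; [case: odd | lia].
have q2 : (k * (9 * k - 5))./2 * 2 = k * (9 * k - 5).
  by rewrite muln2 even_halfK // oddM oddB ?oddM //=; [case: odd | lia].
have := bin2_mul #|X|; rewrite cardX => b2.
apply: (@partitionable_of_3_types _ X (3 * k) 1 1 k.-1
  (k * (9 * k - 5))./2 0 3 (k - 2) (k * (9 * k - 1))./2 0 0 k) => //; rewrite cardX.
1-4: lia.
all: move: p2 q2 b2; set p := _./2; set q := _./2; set b := 'C(_, _).
all: clearbody p q b; clear -k_gt1; case: (k) k_gt1 => // j _; lia.
Qed.

Lemma partitionable_mod3_2 (T : finType) (X : {set T}) :
  #|X| = 2 %[mod 3] -> partitionable_into_parallel_classes X (subsets_multiset X).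
Proof.
move=> mod3; pose k := #|X| %/ 3.
have cardX : #|X| = 3 * k + 2 by rewrite /k; lia.
have X0 : X != set0 by rewrite -card_gt0 cardX addn2.
have := bin2_mul #|X|; rewrite cardX => b2.
(* For [n = 2] the type [(1, 2, k-1)] does not exist; one class of two singletons and three copies
   of the class [{X}] do. *)
have [k0|k_gt0] := posnP k.
  apply: (@partitionable_of_3_types _ X 1 2 0 0 3 0 1 0 0 0 0 0) => //;
    by rewrite cardX k0 //; auto.
have q2 : ((3 * k + 2) * (k - 1))./2 * 2 = (3 * k + 2) * (k - 1).
  by rewrite muln2 even_halfK // oddM oddB // oddD oddM /=; case: odd.
(* For [k = 1] the entry [k - 2] below is truncated, but then [q = 0]. *)
pose q := ((3 * k + 2) * (k - 1))./2; rewrite -/q in q2.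
apply: (@partitionable_of_3_types _ X (3 * k + 2) 1 2 k.-1
  q 0 4 (k - 2) ((3 * k + 2) * (3 * k + 1) - q) 0 1 k) => //; rewrite cardX.
1-3: lia.
all: move: q2 b2; set b := 'C(_, _); clearbody q b; clear -k_gt0; case: (k) k_gt0 => // j _.
all: have -> : 3 * j.+1 + 2 = 3 * j + 5 by lia.
all: rewrite subSS subn0 => q2 b2.
(* Hence [q <= n(n-1)], so the subtraction in the third type is not truncated. *)
all: have : q * 2 <= (3 * j + 5) * (3 * j.+1 + 1) by rewrite q2 leq_mul2l; lia.
all: lia.
Qed.

(** * The equivalence, with necessity by counting *)

Theorem theorem5p1 (T : finType) (X : {set T}) (hX : X != set0) :
  partitionable_into_parallel_classes X (subsets_multiset X) <->
  #|X| = 1 \/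
  ((#|X| = 0 %[mod 3] \/ #|X| = 2 %[mod 3]) /\ #|X| <> 3).
Proof.
split=> [/partitionableP[Ps parPs sumPs]|[card1|[[mod0|mod2] neq3]]]; last first.
- exact: partitionable_mod3_2.
- exact: partitionable_mod3_0.
- by apply: (@partitionable_of_3_types _ X 1 1 0 0 0 0 0 0 0 0 0 0); rewrite ?card1 //; auto.
have := sum_block_count 1 parPs sumPs; have := sum_block_count 2 parPs sumPs.
have := sum_block_count 3 parPs sumPs; rewrite bin1 /=.
have X_gt0 : 0 < #|X| by rewrite card_gt0.
have classP P : P \in Ps ->
  block_count 1 P + 2 * block_count 2 P + 3 * block_count 3 P = #|X|.
  by move=> PPs; apply: parallel_class_card; apply: (allP parPs).
have := bin2_mul #|X|; have := bin3_mul #|X| => b3 b2 s3 s2 s1.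
have size_Ps : size Ps = #|X| ^ 2.
  (* Points counted with multiplicity: [n + 3n(n-1) + n(n-1)(n-2) = n ^ 3]. *)
  have : \sum_(P <- Ps) #|X| = #|X| ^ 3.
    rewrite -(eq_big_seq _ classP) 2!big_split -!big_distrr s1 s2 s3 /=.
    by case: #|X| b2 b3 X_gt0 => // -[|k] /=; nia.
  by rewrite big_const_seq count_predT iter_addn_0 expnS => /eqP;
    rewrite eqn_pmul2l // => /eqP.
have [card1|neq1] := eqVneq #|X| 1; [by left | right; split].
  suff : #|X| %% 3 != 1 by lia.
  apply/negP => /eqP mod1.
  (* From [a + 2b + 3c = 1 mod 3], doubling gives [2a + b = 2 mod 3], hence at least 2. *)
  have : \sum_(P <- Ps) 2 <= \sum_(P <- Ps) (2 * block_count 1 P + block_count 2 P).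
    rewrite [leqLHS]big_seq [leqRHS]big_seq; apply: leq_sum => P /classP; lia.
  rewrite big_split -big_distrr /= s1 s2 big_const_seq count_predT iter_addn_0 size_Ps.
  by case: #|X| b2 X_gt0 neq1 => // -[|k] /=; nia.
(* In a partition of three points a pair leaves a singleton. *)
move=> card3; have : \sum_(P <- Ps) block_count 2 P <= \sum_(P <- Ps) block_count 1 P.
  rewrite [leqLHS]big_seq [leqRHS]big_seq; apply: leq_sum => P /classP; lia.
by rewrite s1 s2 card3.
Qed.
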